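(* Let $\mathbf{k}$ be a field of characteristic zero, $n\ge 1$, and $R=\mathbf{k}[x_1,\dots,x_n]$. The squarefree algebra $R/(x_1^2,\dots,x_n^2)$ has the strong Lefschetz property, and for every integer $k\ge 1$ the algebra $R/I_{n,k}$, where $I_{n,k}=(x_1^2,\dots,x_n^2,(x_1+\cdots+x_n)^k)$, is thin.
   Context: An Artinian standard graded algebra $A$ has the strong Lefschetz property (SLP) if there exists a linear form $\ell$ such that the multiplication map $\cdot\ell^k:A_i\to A_{i+k}$ has maximal rank (is injective or surjective) for all $i$ and $k$. The quotient of $\mathbf{k}[x_1,\dots,x_n]$ by an ideal generated by forms of degrees $a_1,\dots,a_m$ is called thin if its Hilbert series equals $\left[\frac{\prod_{i=1}^m(1-t^{a_i})}{(1-t)^n}\right]$, where the brackets denote truncation of the power series at (i.e. just before) its first non-positive coefficient. For $R/I_{n,k}$ the degrees are $2,\dots,2$ ($n$ times) and $k$. *)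

(* Defs.v *)
From mathcomp Require Import all_boot all_order all_algebra.
From mathcomp Require Import mpoly.

Set Implicit Arguments.
Unset Strict Implicit.
Unset Printing Implicit Defensive.
Import GRing.Theory.
Local Open Scope ring_scope.

(** * Graded quotients of a polynomial ring

    A subset of [{mpoly K[n]}] is a predicate [I]. The algebra [A = R/I] is
    handled through representatives: equality in [A] is congruence modulo
    [I], and [A_d] is the set of classes of forms of degree [d]. *)

Section Quotients.

Variables (n : nat) (K : fieldType).
Implicit Types (I : {mpoly K[n]} -> Prop) (p q : {mpoly K[n]}).
Implicit Types (g : seq {mpoly K[n]}).

Definition is_ideal I : Prop :=
  [/\ I 0, forall p q, I p -> I q -> I (p + q) & forall p q, I q -> I (p * q)].

Definition ideal_gen g : {mpoly K[n]} -> Prop :=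
  fun p => exists c : 'I_(size g) -> {mpoly K[n]},
    p = \sum_(i < size g) c i * g`_i.

Definition eqmod I p q : Prop := I (p - q).

(* With [R] standard graded, this says that [R/I] is standard graded. *)
Definition homogeneous_ideal I : Prop :=
  is_ideal I /\ forall p, I p -> forall d, I (pihomog mdeg d p).

(* Descending chain condition on the ideals of [R/I], which correspond to the
   ideals of [R] containing [I]. *)
Definition artinian_quotient I : Prop :=
  forall J : nat -> {mpoly K[n]} -> Prop,
    (forall i, is_ideal (J i)) ->
    (forall i p, I p -> J i p) ->
    (forall i p, J i.+1 p -> J i p) ->
    exists N, forall i, (N <= i)%N -> forall p, J i p <-> J N p.

(* Multiplication by the class of [f], a form of degree [j - i], as a map from
   [A_i] to [A_j]. *)
Definition mul_injective I (f : {mpoly K[n]}) (i : nat) : Prop :=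
  forall p q, p \is i.-homog -> q \is i.-homog ->
    eqmod I (f * p) (f * q) -> eqmod I p q.

Definition mul_surjective I (f : {mpoly K[n]}) (i j : nat) : Prop :=
  forall q, q \is j.-homog ->
    exists2 p, p \is i.-homog & eqmod I (f * p) q.

Definition mul_maximal_rank I f i j : Prop :=
  mul_injective I f i \/ mul_surjective I f i j.

(* The Lefschetz property is a property of Artinian standard graded algebras,
   so these two conditions on [R/I] are part of the definition. *)
Definition strong_lefschetz I : Prop :=
  [/\ homogeneous_ideal I, artinian_quotient I &
      exists2 l : {mpoly K[n]}, l \is 1.-homog &
        forall i k : nat, mul_maximal_rank I (l ^+ k) i (i + k)].

(* [dim_K A_d = h]: the classes of some [h] forms of degree [d] are a [K]-basis
   of [A_d]. *)
Definition has_dim I (d h : nat) : Prop :=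
  exists e : 'I_h -> {mpoly K[n]},
    [/\ forall i, e i \is d.-homog,
        forall p, p \is d.-homog ->
          exists c : 'I_h -> K, eqmod I p (\sum_(i < h) c i *: e i) &
        forall c : 'I_h -> K,
          eqmod I (\sum_(i < h) c i *: e i) 0 -> forall i, c i = 0].

Definition hilbert_function I (H : nat -> nat) : Prop :=
  forall d, has_dim I d (H d).

End Quotients.

(** * Integer power series, as coefficient sequences *)

(* [u(t) / (1 - t)]: dividing by [1 - t] takes partial sums of coefficients. *)
Definition series_div1t (u : nat -> int) : nat -> int :=
  fun d => \sum_(i < d.+1) u i.

(* [prod_(e in a) (1 - t^e) / (1 - t)^n] *)
Definition expected_series (n : nat) (a : seq nat) : nat -> int :=
  iter n series_div1t (fun d => (\prod_(e <- a) (1 - 'X^e) : {poly int})`_d).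

(* [[u(t)]]: all coefficients from the first non-positive one on become 0. *)
Definition truncate_series (u : nat -> int) : nat -> int :=
  fun d => if [forall j : 'I_d.+1, 0 < u j] then u d else 0.

(* [K[x_1..x_n]/(g)] is thin, for forms [g] of respective degrees [a]. *)
Definition thin (n : nat) (K : fieldType)
    (g : seq {mpoly K[n]}) (a : seq nat) : Prop :=
  all2 (fun p d => p \is d.-homog) g a /\
  exists2 H : nat -> nat, hilbert_function (ideal_gen g) H &
    forall d, (H d)%:Z = truncate_series (expected_series n a) d.

Definition var_squares (n : nat) (K : fieldType) : seq {mpoly K[n]} :=
  [seq 'X_i ^+ 2 | i <- enum 'I_n].

(* Generators of [I_{n,k}]. *)
Definition Ink_gens (n : nat) (K : fieldType) (k : nat) : seq {mpoly K[n]} :=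
  rcons (var_squares n K) ((\sum_(i < n) 'X_i) ^+ k).

(* Main.v *)
(** Modulo the squares, a polynomial is determined by its squarefree
    coefficients, so [R/(x_1^2, ..., x_n^2)] is the space of functions on the
    subsets of [{1..n}], and multiplication by [x_1 + ... + x_n] becomes the
    raising operator [U] of the Boolean lattice. With the lowering operator
    [D] one has [DU - UD = n - 2d] in degree [d], hence
    [D U^k = U^k D + k (n - 2d - k + 1) U^(k-1)] there. If [U^k v = 0] with
    [2d + k <= n], then [U^(k+1) D v = 0], so [D v = 0] by induction on [d];
    the relation then gives [U^(k-1) v = 0], as the scalar is nonzero in
    characteristic zero, and [v = 0] by induction on [k]. Since degrees [d]
    and [n - d] have equal dimension, the injections [U^(n-2d)] are bijections,
    and the surjectivity of [U^k] for [2d + k >= n] follows. The Hilbert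
    function of [R/I_{n,k}] at [d] is the corank of [U^k] into degree [d]. *)

From HB Require Import structures.
From Stdlib Require Import Classical_Prop.
Require Import Defs.
From mathcomp Require Import all_boot all_order all_algebra.
From mathcomp Require Import mpoly ring zify.

Set Implicit Arguments.
Unset Strict Implicit.
Unset Printing Implicit Defensive.
Import GRing.Theory.
Local Open Scope ring_scope.

(** * Raising and lowering operators of the Boolean lattice *)

Section BooleanLattice.

Variables (K : fieldType) (T : finType).

Notation V := {ffun {set T} -> K^o}.
Implicit Types (u v : V) (S : {set T}).

Definition up v : V := [ffun S : {set T} => \sum_(i in S) v (S :\ i)].
Definition down v : V := [ffun S : {set T} => \sum_(i in ~: S) v (i |: S)].
Definition rank_part (d : nat) v : V :=
  [ffun S : {set T} => if #|S| == d then v S else 0].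

Fact up_is_linear : linear up.
Proof.
move=> a u v; apply/ffunP=> S; rewrite !ffunE scaler_sumr -big_split /=.
by apply: eq_bigr => i _; rewrite !ffunE.
Qed.
HB.instance Definition _ := GRing.isLinear.Build K V V _ up up_is_linear.

Fact down_is_linear : linear down.
Proof.
move=> a u v; apply/ffunP=> S; rewrite !ffunE scaler_sumr -big_split /=.
by apply: eq_bigr => i _; rewrite !ffunE.
Qed.
HB.instance Definition _ := GRing.isLinear.Build K V V _ down down_is_linear.

Fact rank_part_is_linear d : linear (rank_part d).
Proof.
move=> a u v; apply/ffunP=> S; rewrite !ffunE.
by case: ifP; rewrite ?scaler0 ?addr0.
Qed.
HB.instance Definition _ d :=
  GRing.isLinear.Build K V V _ (rank_part d) (rank_part_is_linear d).

Definition upn k v : V := iter k up v.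

Fact upn_is_linear k : linear (upn k).
Proof.
by move=> a u v; rewrite /upn; elim: k => //= k ->; rewrite linearP.
Qed.
HB.instance Definition _ k :=
  GRing.isLinear.Build K V V _ (upn k) (upn_is_linear k).

Definition ranked (d : nat) v := forall S, #|S| != d -> v S = 0.

Lemma ranked_rank_part d v : ranked d (rank_part d v).
Proof. by move=> S /negPf neq; rewrite ffunE neq. Qed.

Lemma rank_part_id d v : ranked d v -> rank_part d v = v.
Proof. by move=> rv; apply/ffunP=> S; rewrite ffunE; case: eqVneq => // /rv. Qed.

Lemma ranked_up d v : ranked d v -> ranked d.+1 (up v).
Proof.
move=> rv S neq; rewrite ffunE big1 // => i iS; apply: rv.
by move: neq; rewrite (cardsD1 i S) iS.
Qed.

Lemma ranked_upn k d v : ranked d v -> ranked (d + k)%N (upn k v).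
Proof.
by move=> rv; elim: k => [|k IH]; [rewrite addn0 | rewrite addnS; apply: ranked_up].
Qed.

Lemma ranked_down d v : ranked d.+1 v -> ranked d (down v).
Proof.
move=> rv S neq; rewrite ffunE big1 // => i; rewrite in_setC => iS; apply: rv.
by rewrite cardsU1 iS.
Qed.

Lemma down_rank0 v : ranked 0 v -> down v = 0.
Proof.
move=> rv; apply/ffunP=> S; rewrite !ffunE big1 // => i; rewrite in_setC => iS.
by apply: rv; rewrite cardsU1 iS.
Qed.

Lemma rank_part_up d v : rank_part d.+1 (up v) = up (rank_part d v).
Proof.
apply/ffunP=> S; rewrite !ffunE; case: ifP => cS.
  apply: eq_bigr => i iS; rewrite ffunE.
  by move: cS; rewrite (cardsD1 i S) iS add1n eqSS => ->.
rewrite big1 // => i iS; rewrite ffunE.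
by move: cS; rewrite (cardsD1 i S) iS add1n eqSS => ->.
Qed.

Lemma rank_part_upn d k v : rank_part (d + k)%N (upn k v) = upn k (rank_part d v).
Proof.
by elim: k => [|k IH]; rewrite ?addn0 // addnS rank_part_up IH.
Qed.

Lemma rank_part0_up v : rank_part 0 (up v) = 0.
Proof.
apply/ffunP=> S; rewrite !ffunE; case: ifP => // /eqP /cards0_eq ->.
by rewrite big_set0.
Qed.

Lemma rank_part_upn_small d k v : (d < k)%N -> rank_part d (upn k v) = 0.
Proof.
elim: k d => // k IH [|d] lt_dk; first exact: rank_part0_up.
by rewrite rank_part_up IH // linear0.
Qed.

(** In both composites, an element added and a different one removed may be exchanged, so those
    terms cancel. What remains is [v S] once per element outside [S] in [down (up v)], and once per
    element of [S] in [up (down v)]. *)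
Lemma down_up d v : ranked d v ->
  down (up v) = up (down v) + (#|T|%:R - (d.*2)%:R) *: v.
Proof.
move=> rv; apply/ffunP=> S; rewrite !ffunE.
under eq_bigr => i.
  rewrite in_setC => iS; rewrite ffunE (bigD1 i) ?setU11 //= setU1K //.
  rewrite (eq_bigl (mem S)); last first.
    move=> j; rewrite !inE.
    by case: eqVneq => [->|]; rewrite ?andbT // (negPf iS).
  over.
rewrite big_split /=.
under [X in _ = X + _]eq_bigr => i iS.
  rewrite ffunE (bigD1 i) ?inE ?eqxx //= setD1K //.
  rewrite (eq_bigl (mem (~: S))); last first.
    by move=> j; rewrite !inE; case: eqVneq => [->|]; rewrite ?iS ?andbT.
  over.
rewrite big_split /= !sumr_const [in X in _ = _ + X + _]exchange_big /=.
have -> : \sum_(i in ~: S) \sum_(j in S) v ((i |: S) :\ j)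
   = \sum_(i in ~: S) \sum_(j in S) v (i |: (S :\ j)).
  apply: eq_bigr => i; rewrite in_setC => iS; apply: eq_bigr => j jS.
  have ne_ij : i != j by apply: contraNneq iS => ->.
  congr (v _); apply/setP=> x; rewrite !inE.
  by case: (eqVneq x i) => // ->; rewrite ne_ij.
(* Outside rank [d] the leftover terms vanish with [v S]; in rank [d] they differ by the factor
   [#|~: S| - #|S|]. *)
case: (eqVneq #|S| d) => [<-|/rv ->]; last first.
  by rewrite !mul0rn scaler0 add0r addr0.
have -> : #|T|%:R = (#|S| + #|~: S|)%:R :> K by rewrite cardsC.
rewrite addrAC; congr (_ + _).
rewrite -!scaler_nat -scalerDl natrD -addnn natrD; congr (_ *: _).
by move: (#|S|%:R : K) (#|~: S|%:R : K) => a b; ring.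
Qed.

(** The scalar is the sum of the [down_up] contributions [#|T| - 2 (d + j)] of the ranks [d + j],
    for [j < k]. *)
Lemma down_upn k d v : ranked d v ->
  down (upn k v) = upn k (down v)
    + (k%:R * (#|T|%:R - (d.*2)%:R - k%:R + 1)) *: upn k.-1 v.
Proof.
move=> rv; elim: k => [|k IH]; first by rewrite mul0r scale0r addr0.
rewrite [upn k.+1 v]/= (down_up (ranked_upn (k := k) rv)) IH.
rewrite linearD linearZ /= -addrA.
(* For [k = 0] the vectors [up (upn k.-1 v)] and [upn k v] may differ, but the coefficient is
   zero. *)
have -> : (k%:R * (#|T|%:R - d.*2%:R - k%:R + 1)) *: up (upn k.-1 v)
   = (k%:R * (#|T|%:R - d.*2%:R - k%:R + 1)) *: upn k v.
  by case: k {IH} => [|k] //; rewrite !mul0r !scale0r.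
rewrite -scalerDl; congr (_ + _ *: _).
rewrite doubleD natrD -[in RHS]addn1 -[k.*2]addnn !natrD; ring.
Qed.

Hypothesis charK : [pchar K] =i pred0.

Lemma upn_primitive k d v : ranked d v -> (d.*2 + k < #|T|)%N ->
  down v = 0 -> upn k.+1 v = 0 -> upn k v = 0.
Proof.
move=> rv lt_k Dv0 Uv0; have := down_upn k.+1 rv.
rewrite Uv0 Dv0 !linear0 add0r => /esym/eqP; rewrite scaler_eq0 => /orP[|/eqP//].
have -> : #|T|%:R - d.*2%:R - k.+1%:R + 1 = (#|T| - (d.*2 + k))%:R :> K.
  by rewrite natrB 1?ltnW // natrD -(natr1 k) !opprD !addrA addrNK.
by rewrite -natrM (pcharf0P K).1 // muln_eq0 subn_eq0 leqNgt lt_k.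
Qed.

Lemma upn_inj k d v : ranked d v -> (d.*2 + k <= #|T|)%N -> upn k v = 0 -> v = 0.
Proof.
elim: d k v => [|d IHd] k v rv; elim: k => // k IHk le_n Uv0; apply: IHk; try lia.
all: apply: (upn_primitive rv _ _ Uv0); first lia.
- exact: down_rank0 rv.
apply: (IHd k.+2); [exact: ranked_down rv | lia |].
(* One more [up] turns the correction term into a multiple of [upn k.+1 v], which is zero, and
   leaves [upn k.+2 (down v) = 0]. *)
have /(congr1 up) := down_upn k.+1 rv.
by rewrite Uv0 !linear0 linearD linearZ /= [up (upn k v)]Uv0 scaler0 addr0.
Qed.

(** * Rank subspaces, images of [upn k] and their coranks *)

Definition rankv (d : nat) : {vspace V} := limg (linfun (rank_part d)).

Lemma rankvP d v : reflect (ranked d v) (v \in rankv d).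
Proof.
apply: (iffP memv_imgP) => [[w _ ->]|rv]; last exists v; rewrite ?memvf ?lfunE //=.
  exact: ranked_rank_part.
by rewrite rank_part_id.
Qed.

(** The indicator functions of the [d]-subsets form a basis. *)
Lemma dim_rankv d : \dim (rankv d) = 'C(#|T|, d).
Proof.
pose D := enum [set S : {set T} | #|S| == d].
pose delta S : V := [ffun S' : {set T} => (S' == S)%:R].
have D_S S : (S \in D) = (#|S| == d) by rewrite mem_enum inE.
have freeD : free (map delta D).
  rewrite -[map delta D]/(tval (map_tuple delta (in_tuple D))).
  apply/freeP => c sum0 i; move/ffunP/(_ (nth set0 D i)): sum0.
  rewrite sum_ffunE (bigD1 i) //= big1 ?addr0 => [|j ne_ji];
    rewrite !ffunE (nth_map set0) // ffunE.
    by rewrite eqxx => <-; apply/esym/mulr1.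
  by rewrite nth_uniq ?enum_uniq // eq_sym (inj_eq val_inj) (negPf ne_ji) scaler0.
have -> : rankv d = <<map delta D>>%VS.
  apply/eqP; rewrite eqEsubv; apply/andP; split.
    apply/subvP=> v /rankvP rv.
    have -> : v = \sum_(S <- D) v S *: delta S.
      apply/ffunP=> S; rewrite sum_ffunE.
      case: (boolP (S \in D)) => [SD|SnD].
        rewrite (bigD1_seq S) ?enum_uniq //= big1 ?addr0 => [|S' ne]; rewrite !ffunE.
          by rewrite eqxx; apply/esym/mulr1.
        by rewrite eq_sym (negPf ne) scaler0.
      rewrite rv -?D_S // big_seq big1 // => S' S'D; rewrite !ffunE.
      by case: eqVneq => [eqS|_]; [rewrite eqS S'D in SnD | apply: scaler0].
    rewrite big_seq memv_suml // => S SD; rewrite memvZ // memv_span //.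
    exact: map_f.
  apply/span_subvP=> _ /mapP[S SD ->]; apply/rankvP => S' ne; rewrite ffunE.
  by case: eqVneq => // eqS; rewrite eqS -D_S SD in ne.
by rewrite (eqnP freeD) size_map -cardE card_draws.
Qed.

Lemma img_upn_subv k d : (linfun (upn k) @: rankv d <= rankv (d + k)%N)%VS.
Proof.
apply/subvP=> _ /memv_imgP[v /rankvP rv ->]; rewrite lfunE /=.
exact/rankvP/ranked_upn.
Qed.

Lemma dim_img_upn k d : (d.*2 + k <= #|T|)%N ->
  \dim (linfun (upn k) @: rankv d) = 'C(#|T|, d).
Proof.
move=> le_n; rewrite -dim_rankv; apply: limg_dim_eq; apply/eqP; rewrite -subv0.
apply/subvP=> v; rewrite memv_cap => /andP[/rankvP rv]; rewrite memv_ker lfunE.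
by move=> /eqP /(upn_inj rv le_n) ->; rewrite mem0v.
Qed.

(** With [m] the rank complementary to [d + k], the map from rank [m] to rank [d + k] is injective
    between equal dimensions, hence onto. Since [m <= d], it factors through rank [d]. *)
Lemma img_upn k d : (#|T| <= d.*2 + k)%N ->
  (linfun (upn k) @: rankv d = rankv (d + k)%N)%VS.
Proof.
move=> le_n; apply/eqP; rewrite eqEsubv img_upn_subv /=.
(* Beyond rank [#|T|] the target is zero; this leaves the case where the subtraction defining [m] is
   not truncated. *)
case: (ltnP #|T| (d + k)) => [lt_n|le_dk].
  suff /eqP-> : rankv (d + k)%N == 0%VS by rewrite sub0v.
  by rewrite -dimv_eq0 dim_rankv bin_small.
pose m := (#|T| - (d + k))%N.
have eq_m : (d + k = m + (d + k - m))%N by rewrite /m; lia.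
have -> : rankv (d + k)%N = (linfun (upn (d + k - m)) @: rankv m)%VS.
  apply/esym/eqP; rewrite eqEdim {2}eq_m img_upn_subv dim_img_upn; last first.
    by rewrite /m; lia.
  by rewrite dim_rankv bin_sub //=.
apply/subvP=> _ /memv_imgP[v /rankvP rv ->]; apply/memv_imgP.
exists (upn (d - m) v); last first.
  by rewrite !lfunE /= /upn -iterD; congr iter; rewrite /m; lia.
apply/rankvP; have {1}-> : d = (m + (d - m))%N by rewrite /m; lia.
exact: ranked_upn.
Qed.

(** As [upn k] raises rank by exactly [k], only the rank [d - k] part of a preimage contributes in
    rank [d]. *)
Lemma cap_rankv_limg_upn k d : (rankv d :&: limg (linfun (upn k)) =
  if (k <= d)%N then linfun (upn k) @: rankv (d - k)%N else 0)%VS.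
Proof.
apply/eqP; rewrite eqEsubv; apply/andP; split.
  apply/subvP=> v /memv_capP[/rankvP rv /memv_imgP[w _ eq_v]].
  rewrite lfunE /= in eq_v; rewrite -(rank_part_id rv) eq_v.
  case: (leqP k d) => [le_kd|lt_dk]; last by rewrite rank_part_upn_small ?mem0v.
  rewrite -{1}(subnK le_kd) rank_part_upn; apply/memv_imgP.
  exists (rank_part (d - k) w); last by rewrite lfunE.
  exact/rankvP/ranked_rank_part.
case: leqP => [le_kd|_]; last exact: sub0v.
rewrite subv_cap -{2}(subnK le_kd) img_upn_subv /=; exact: limgS (subvf _).
Qed.

(** The image of the whole space is used, so that the definition needs no case distinction on
    [k <= d]. *)
Definition corank (k d : nat) := \dim (rankv d :\: limg (linfun (upn k))).

Lemma corankE k d : (d.*2 < #|T| + k)%N ->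
  corank k d = ('C(#|T|, d) - (if (k <= d)%N then 'C(#|T|, d - k) else 0))%N.
Proof.
move=> lt_d; rewrite -dim_rankv -(dimv_cap_compl _ (limg (linfun (upn k)))).
rewrite cap_rankv_limg_upn; case: ifP => le_kd; last by rewrite dimv0 subn0.
by rewrite dim_img_upn ?addKn //; lia.
Qed.

Lemma corank_eq0 k d : (0 < k)%N -> (#|T| + k <= d.*2)%N -> corank k d = 0%N.
Proof.
move=> k_gt0 le_d; apply/eqP; rewrite dimv_eq0 diffv_eq0; apply/capv_idPl.
rewrite cap_rankv_limg_upn; case: leqP => [le_kd|lt_dk].
  by rewrite img_upn ?subnK //; lia.
by apply/esym/eqP; rewrite -dimv_eq0 dim_rankv bin_small //; lia.
Qed.

(** A dimension count for the surjection [upn k] from rank [d - k]; it makes the expected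
    coefficient at [d] non-positive. *)
Lemma bin_sub_leq k d : (#|T| + k <= d.*2)%N ->
  ('C(#|T|, d) <= if (k <= d)%N then 'C(#|T|, d - k) else 0)%N.
Proof.
move=> le_d; case: (leqP k d) => [le_kd|lt_dk]; last by rewrite bin_small //; lia.
rewrite -[d in 'C(_, d)](subnK le_kd) -2!dim_rankv -img_upn; last lia.
by rewrite -(limg_ker_dim (linfun (upn k)) (rankv (d - k))) leq_addl.
Qed.

End BooleanLattice.

(** * The expected Hilbert series *)

Section ExpectedSeries.

Lemma eq_iter_series m (u w : nat -> int) :
  u =1 w -> iter m series_div1t u =1 iter m series_div1t w.
Proof.
by move=> eq_uw; elim: m => //= m IH d; apply: eq_bigr => i _; apply: IH.
Qed.

Lemma series_div1tM (p : {poly int}) :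
  series_div1t (fun d => ((1 - 'X) * p)`_d) =1 (fun d => p`_d).
Proof.
move=> d; rewrite /series_div1t; elim: d => [|d IH].
  by rewrite big_ord1 mulrBl mul1r coefB coefXM subr0.
by rewrite big_ord_recr /= IH mulrBl mul1r coefB coefXM /= addrC subrK.
Qed.

Lemma iter_series_div1tM m (p : {poly int}) :
  iter m series_div1t (fun d => ((1 - 'X) ^+ m * p)`_d) =1 (fun d => p`_d).
Proof.
elim: m => [|m IH] d; first by rewrite /= mul1r.
rewrite iterSr -IH; apply: eq_iter_series => e.
by rewrite exprS -mulrA series_div1tM.
Qed.

(** The series is [(1 + t)^n (1 - t^k)], because [1 - t^2 = (1 - t) (1 + t)]. *)
Lemma expected_seriesE n k d : expected_series n (rcons (nseq n 2%N) k) d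
  = 'C(n, d)%:Z - (if (k <= d)%N then 'C(n, d - k) else 0)%N%:Z.
Proof.
have coef1DX e : ((1 + 'X) ^+ n : {poly int})`_e = 'C(n, e)%:Z.
  rewrite addrC exprD1n coef_sum; case: (ltnP e n.+1) => [lt_e|le_n].
    rewrite (bigD1 (Ordinal lt_e)) //= big1 ?addr0 => [|i ne];
      rewrite coefMn coefXn.
      by rewrite eqxx natz.
    by rewrite eq_sym (negPf ne : (i == e :> nat) = false) mul0rn.
  rewrite big1 ?bin_small // => i _; rewrite coefMn coefXn gtn_eqF ?mul0rn //.
  exact: leq_trans le_n.
rewrite /expected_series big_rcons big_nseq /= iter_mulr_1.
rewrite -[1 - 'X^2](_ : (1 - 'X) * (1 + 'X) = _); last first.
  by rewrite -subr_sqr expr1n.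
rewrite exprMn -mulrA iter_series_div1tM mulrBr mulr1 coefB coef1DX coefMXn.
by rewrite coef1DX ltnNge if_neg; case: ifP.
Qed.

Lemma ltn_binS n m : (m.*2.+1 < n)%N -> ('C(n, m) < 'C(n, m.+1))%N.
Proof.
move=> lt_mn; have bin_m : (0 < 'C(n, m))%N by rewrite bin_gt0; lia.
by have := mul_bin_left n m; nia.
Qed.

Lemma ltn_bin_half n a b : (a < b)%N -> (b.*2 <= n)%N -> ('C(n, a) < 'C(n, b))%N.
Proof.
elim: b => // b IH; rewrite ltnS leq_eqVlt => /orP[/eqP->|lt_ab] le_bn.
  by apply: ltn_binS; lia.
by apply: ltn_trans (ltn_binS _); [apply: IH|]; lia.
Qed.

(** When [b] lies past the middle, the symmetry [b -> n - b] returns to the increasing half, and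
    [a < n - b] still holds. *)
Lemma ltn_bin n a b : (a < b)%N -> (a + b < n)%N -> ('C(n, a) < 'C(n, b))%N.
Proof.
move=> lt_ab lt_n; case: (leqP b.*2 n) => [|lt_nb]; first exact: ltn_bin_half.
by rewrite -(@bin_sub n b); [apply: ltn_bin_half|]; lia.
Qed.

End ExpectedSeries.

(** * Squarefree coefficients *)

Section IdealGen.

Variables (n : nat) (K : fieldType).
Implicit Types (p q f : {mpoly K[n]}) (g : seq {mpoly K[n]}).

Lemma is_ideal_gen g : is_ideal (ideal_gen g).
Proof.
split=> [|p q [c ->] [c' ->]|p q [c ->]].
- by exists (fun=> 0); rewrite big1 // => i _; rewrite mul0r.
- exists (fun i => c i + c' i); rewrite -big_split /=.
  by apply: eq_bigr => i _; rewrite mulrDl.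
- exists (fun i => p * c i); rewrite mulr_sumr.
  by apply: eq_bigr => i _; rewrite mulrA.
Qed.

Lemma mem_ideal_gen g f : f \in g -> ideal_gen g f.
Proof.
move=> gf; have lt_f : (index f g < size g)%N by rewrite index_mem.
exists (fun i => (i == Ordinal lt_f)%:R); rewrite (bigD1 (Ordinal lt_f)) //= eqxx.
rewrite mul1r nth_index // big1 ?addr0 // => i /negPf->; exact: mul0r.
Qed.

Lemma ideal_sum (J : {mpoly K[n]} -> Prop) (I : eqType) (r : seq I)
    (F : I -> {mpoly K[n]}) :
  is_ideal J -> (forall i, i \in r -> J (F i)) -> J (\sum_(i <- r) F i).
Proof.
case=> J0 JD _ JF; rewrite big_seq; elim/big_ind: _ => //; exact: JD.
Qed.

Lemma ideal_gen_min g (J : {mpoly K[n]} -> Prop) :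
  is_ideal J -> (forall f, f \in g -> J f) -> forall p, ideal_gen g p -> J p.
Proof.
move=> idJ Jg p [c ->]; apply: ideal_sum => // i _; case: (idJ) => _ _; apply.
exact/Jg/mem_nth.
Qed.

(** In this form, membership says that the class of [p] modulo [g] lies in the image of
    multiplication by [f]. *)
Lemma ideal_gen_rcons g f p :
  ideal_gen (rcons g f) p <-> exists c, ideal_gen g (p - f * c).
Proof.
have [g0 gD gM] := is_ideal_gen g; have [h0 hD hM] := is_ideal_gen (rcons g f).
split=> [|[c gp]].
  apply: (@ideal_gen_min _ (fun q => exists c, ideal_gen g (q - f * c))) => [|q].
    split=> [|q r [c gq] [c' gr]|q r [c gr]].
    - by exists 0; rewrite mulr0 subr0.
    - by exists (c + c'); rewrite mulrDr opprD addrACA; apply: gD.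
    - by exists (q * c); rewrite mulrCA -mulrBr; apply: gM.
  rewrite mem_rcons inE => /orP[/eqP->|/mem_ideal_gen gq].
    by exists 1; rewrite mulr1 subrr.
  by exists 0; rewrite mulr0 subr0.
rewrite -(subrK (f * c) p); apply: hD.
  apply: ideal_gen_min gp => [|q gq]; [exact: is_ideal_gen | apply: mem_ideal_gen].
  by rewrite mem_rcons inE gq orbT.
by rewrite mulrC; apply/hM/mem_ideal_gen; rewrite mem_rcons mem_head.
Qed.

End IdealGen.

(** * The squarefree algebra and its quotients by powers of the sum of the variables *)

Section SquarefreeAlgebra.

Variables (K : fieldType) (n : nat).

Notation V := {ffun {set 'I_n} -> K^o}.
Notation R := {mpoly K[n]}.
Notation I0 := (ideal_gen (var_squares n K)).
Implicit Types (p q : R) (v w : V).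

Definition sqfree_coef p : V := [ffun S => p@_(mesym1 S)].
Definition sqfree_form v : R := \sum_S v S *: 'X_[mesym1 S].

Fact sqfree_coef_is_linear : linear sqfree_coef.
Proof. by move=> a p q; apply/ffunP=> S; rewrite !ffunE linearP. Qed.
HB.instance Definition _ :=
  GRing.isLinear.Build K R V _ sqfree_coef sqfree_coef_is_linear.

Fact sqfree_form_is_linear : linear sqfree_form.
Proof.
move=> a v w; rewrite /sqfree_form scaler_sumr -big_split /=.
by apply: eq_bigr => S _; rewrite !ffunE scalerDl scalerA.
Qed.
HB.instance Definition _ :=
  GRing.isLinear.Build K V R _ sqfree_form sqfree_form_is_linear.

Lemma sqfree_formK : cancel sqfree_form sqfree_coef.
Proof.
move=> v; apply/ffunP=> S; rewrite ffunE linear_sum (bigD1 S) //= big1 ?addr0.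
  by rewrite mcoeffZ mcoeffX eqxx mulr1.
move=> S' ne; rewrite mcoeffZ mcoeffX (inj_eq (@inj_mesym1 _)).
by rewrite (negPf ne) mulr0.
Qed.

Lemma sqfree_coefXM i p : sqfree_coef ('X_i * p) =
  [ffun S : {set 'I_n} => if i \in S then sqfree_coef p (S :\ i) else 0].
Proof.
apply/ffunP=> S; rewrite !ffunE mulrC; case: ifP => iS.
  have -> : mesym1 S = (U_(i) + mesym1 (S :\ i))%MM.
    apply/mnmP=> j; rewrite mnmDE !mnmE !inE eq_sym.
    by case: eqVneq => [->|]; rewrite ?iS.
  by rewrite mcoeffMX.
(* Every monomial of ['X_i * p] involves ['X_i], whereas [mesym1 S] has exponent zero at [i]. *)
apply: memN_msupp_eq0; rewrite (perm_mem (msuppMX _ _)).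
apply/mapP=> -[m _ /mnmP/(_ i)]; rewrite mnmDE !mnmE iS eqxx; lia.
Qed.

Lemma sqfree_coef_upM p : sqfree_coef ((\sum_i 'X_i) * p) = up (sqfree_coef p).
Proof.
rewrite mulr_suml linear_sum /=; apply/ffunP=> S; rewrite sum_ffunE ffunE.
rewrite [RHS]big_mkcond /=; apply: eq_bigr => i _; rewrite sqfree_coefXM ffunE.
by [].
Qed.

Lemma sqfree_coef_upnM k p :
  sqfree_coef ((\sum_i 'X_i) ^+ k * p) = upn k (sqfree_coef p).
Proof.
elim: k => [|k IH]; first by rewrite mul1r.
by rewrite exprS -mulrA sqfree_coef_upM IH.
Qed.

Lemma mem_var_squares i : I0 ('X_i ^+ 2).
Proof. by apply/mem_ideal_gen/map_f; rewrite mem_enum. Qed.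

Lemma var_squaresP p : I0 p <-> sqfree_coef p = 0.
Proof.
have idI := is_ideal_gen (var_squares n K); split.
  case=> c ->; rewrite linear_sum big1 // => /= i _.
  have /mapP[j _ ->] : (var_squares n K)`_i \in var_squares n K by apply: mem_nth.
  (* The second factor ['X_j] would need [j] to lie in [S :\ j]. *)
  rewrite mulrC expr2 -mulrA !sqfree_coefXM; apply/ffunP=> S; rewrite !ffunE.
  by rewrite !inE eqxx /= if_same.
move=> p0; rewrite (mpolyE p); apply: (ideal_sum idI) => m pm.
rewrite -mul_mpolyC; case: (idI) => _ _ IM; apply: (IM).
(* A monomial with all exponents at most 1 is [mesym1] of its support, and its coefficient in [p] is
   zero by [p0]. *)
have /existsP[i lt_i] : [exists i, (1 < m i)%N].
  apply: contraLR pm; rewrite negb_exists => /forallP m_le1.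
  have -> : m = mesym1 [set i | (0 < m i)%N].
    apply/mnmP=> i; rewrite mnmE inE; move: (m_le1 i); case: (m i) => [|[]] //.
  move/ffunP/(_ [set i | (0 < m i)%N]): p0; rewrite !ffunE => p0.
  by rewrite mcoeff_msupp negbK p0.
have -> : m = ((m - U_(i) *+ 2) + U_(i) *+ 2)%MM.
  rewrite submK //; apply/mnm_lepP=> j; rewrite mulmnE mnm1E.
  by case: eqVneq => [<-|].
by rewrite mpolyXD -mpolyXn; apply/IM/mem_var_squares.
Qed.

Lemma sqfree_coefK p : I0 (p - sqfree_form (sqfree_coef p)).
Proof. by apply/var_squaresP; rewrite linearB /= sqfree_formK subrr. Qed.

Lemma ranked_sqfree_coef d p : p \is d.-homog -> ranked d (sqfree_coef p).
Proof.
move=> /dhomogP hp S neq; rewrite ffunE; apply: memN_msupp_eq0.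
by apply: contra neq => /hp <-; apply/eqP/esym/mdeg_mesym1.
Qed.

Lemma sqfree_form_homog d v : ranked d v -> sqfree_form v \is d.-homog.
Proof.
move=> rv; apply: rpred_sum => S _; case: (eqVneq #|S| d) => [<-|/rv ->].
  by rewrite rpredZ // dhomogX; apply/eqP/mdeg_mesym1.
by rewrite scale0r rpred0.
Qed.

Lemma sqfree_coef_pihomog d p :
  sqfree_coef (pihomog mdeg d p) = rank_part d (sqfree_coef p).
Proof.
rewrite pihomogE [in RHS](mpolyE p) !linear_sum /= big_mkcond /=.
apply: eq_bigr => m _; apply/ffunP=> S; rewrite !ffunE mcoeffZ mcoeffX.
case: (eqVneq m (mesym1 S)) => [->|ne].
  by rewrite mdeg_mesym1; case: ifP; rewrite !ffunE // mcoeffZ mcoeffX eqxx.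
rewrite mulr0 if_same; case: ifP; rewrite !ffunE //.
by rewrite mcoeffZ mcoeffX (negPf ne) mulr0.
Qed.

Lemma homogeneous_var_squares : homogeneous_ideal I0.
Proof.
split=> [|p /var_squaresP p0 d]; first exact: is_ideal_gen.
by apply/var_squaresP; rewrite sqfree_coef_pihomog p0 linear0.
Qed.

Lemma Ink_gensP k p : ideal_gen (Ink_gens n K k) p <->
  sqfree_coef p \in limg (linfun (upn k : V -> V)).
Proof.
split=> [/ideal_gen_rcons[c /var_squaresP]|/memv_imgP[w _]].
  rewrite linearB /= sqfree_coef_upnM => /subr0_eq ->.
  by apply/memv_imgP; exists (sqfree_coef c); rewrite ?memvf ?lfunE.
rewrite lfunE /= => eq_p; apply/ideal_gen_rcons; exists (sqfree_form w).
by apply/var_squaresP; rewrite linearB /= sqfree_coef_upnM sqfree_formK eq_p subrr.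
Qed.

Lemma mul_upn_maximal_rank (charK : [pchar K] =i pred0) i k :
  mul_maximal_rank I0 ((\sum_j 'X_j) ^+ k) i (i + k).
Proof.
case: (leqP (i.*2 + k) n) => [le_n|lt_n]; [left=> p q hp hq|right=> q hq].
  rewrite /eqmod -mulrBr => /var_squaresP; rewrite sqfree_coef_upnM => pq0.
  apply/var_squaresP/(@upn_inj _ _ charK k i _ _ _ pq0); rewrite ?card_ord //.
  by apply: ranked_sqfree_coef; rewrite rpredB.
have : sqfree_coef q \in rankv K 'I_n (i + k) by apply/rankvP/ranked_sqfree_coef.
rewrite -img_upn ?card_ord // 1?ltnW // => /memv_imgP[w /rankvP rw].
rewrite lfunE /= => eq_q; exists (sqfree_form w); first exact: sqfree_form_homog.
by apply/var_squaresP; rewrite linearB /= sqfree_coef_upnM sqfree_formK eq_q subrr.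
Qed.

(** A basis of a complement [W] of the image [U] within rank [d] lifts to the required forms:
    [W + U] contains rank [d], which gives spanning, and [W] meets [U] trivially, which gives
    independence. *)
Lemma hilbert_Ink k :
  hilbert_function (ideal_gen (Ink_gens n K k)) (corank K 'I_n k).
Proof.
move=> d; set U := limg (linfun (upn k : V -> V)).
set W := (rankv K 'I_n d :\: U)%VS; pose e := vbasis W.
have sWA : (W <= rankv K 'I_n d)%VS by apply: diffvSl.
exists (fun i => sqfree_form e`_i); split=> [i|p hp|c].
- apply/sqfree_form_homog/rankvP/(subvP sWA)/vbasis_mem/mem_nth.
  by rewrite size_tuple.
- have : sqfree_coef p \in (W + U)%VS.
    rewrite addv_diff; apply/(subvP (addvSl _ _))/rankvP.
    exact: ranked_sqfree_coef.
  case/memv_addP=> w Ww [u Uu eq_p]; exists (fun i => coord e i w).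
  apply/Ink_gensP; rewrite linearB linear_sum /=.
  under eq_bigr do rewrite linearZ /= sqfree_formK.
  by rewrite -(coord_vbasis Ww) eq_p addrAC subrr add0r.
move=> /Ink_gensP; rewrite subr0 linear_sum /=.
under eq_bigr do rewrite linearZ /= sqfree_formK.
move=> Uc; have : \sum_(i < \dim W) c i *: e`_i \in (W :&: U)%VS.
  rewrite memv_cap Uc andbT memv_suml // => i _; rewrite memvZ //.
  by apply/vbasis_mem/mem_nth; rewrite size_tuple.
rewrite capv_diff memv0 => /eqP; apply/freeP.
exact: basis_free (vbasisP _).
Qed.

Lemma corank_thin (charK : [pchar K] =i pred0) k d : (0 < k)%N ->
  (corank K 'I_n k d)%:Z
    = truncate_series (expected_series n (rcons (nseq n 2%N) k)) d.
Proof.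
move=> k_gt0; have u_gt0 j : (j <= n)%N -> (j.*2 < n + k)%N ->
    ((if (k <= j)%N then 'C(n, j - k) else 0) < 'C(n, j))%N.
  move=> le_jn lt_j; case: ifP => le_kj; last by rewrite bin_gt0.
  by apply: ltn_bin; lia.
rewrite /truncate_series; case: ifP => [/forallP /(_ ord_max)|/negbT/forallPn[j]].
  rewrite !expected_seriesE Num.Theory.subr_gt0 /= => lt_C.
  (* Positivity at [d] excludes [n + k <= d.*2] through [bin_sub_leq], so [corankE] applies. *)
  rewrite corankE ?card_ord //; last first.
    rewrite ltnNge; apply/negP => le_d.
    by have := @bin_sub_leq K 'I_n charK k d; rewrite card_ord => /(_ le_d); lia.
  by rewrite subzn // ltnW.
(* A non-positive coefficient at some [j <= d] leaves two cases: either [upn k] is onto rank [d], or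
   [u_gt0] forces [n < j], and rank [d] itself is zero. *)
rewrite expected_seriesE Num.Theory.subr_gt0 ltz_nat -leqNgt => le_C.
case: (leqP (n + k) d.*2) => [le_d|lt_d].
  by rewrite corank_eq0 ?card_ord.
rewrite corankE ?card_ord // bin_small ?sub0n // ltnNge; apply/negP => le_dn.
by have := u_gt0 j; case: j le_C => j /= lt_j; lia.
Qed.

End SquarefreeAlgebra.

(** * The Artinian property *)

Section Artinian.

(** [Q] need not be decidable, so the descent on [f] uses excluded middle. *)
Lemma exists_min_measure (T : Type) (f : T -> nat) (Q : T -> Prop) :
  (exists t, Q t) -> exists t, Q t /\ forall s, Q s -> (f t <= f s)%N.
Proof.
case=> t; have [m] := ubnP (f t); elim: m t => // m IH t lt_m Qt.
case: (classic (exists s, Q s /\ (f s < f t)%N)) => [[s [Qs lt_s]]|no_s].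
  by apply: (IH s) => //; apply: leq_trans lt_s _.
exists t; split=> // s Qs; rewrite leqNgt; apply/negP => lt_s.
by apply: no_s; exists s.
Qed.

(** A subspace of largest dimension inside [P] contains every vector of [P], since adjoining the
    line through such a vector cannot enlarge it. The minimized measure is the codimension. *)
Lemma submod_vspace (K : fieldType) (vT : vectType K) (P : vT -> Prop) :
  P 0 -> (forall a u v, P u -> P v -> P (a *: u + v)) ->
  exists W : {vspace vT}, forall v, v \in W <-> P v.
Proof.
move=> P0 Plin; pose Q (W : {vspace vT}) := forall v, v \in W -> P v.
have [|W [QW maxW]] := @exists_min_measure _ (fun W => (\dim {:vT} - \dim W)%N) Q.
  by exists 0%VS => v; rewrite memv0 => /eqP ->.
exists W => v; split=> [/QW //|Pv].
have /maxW : Q (<[v]> + W)%VS.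
  by move=> _ /memv_addP[_ /vlineP[a ->] [w /QW Pw ->]]; apply: Plin.
have := dimvS (subvf W); have := dimvS (subvf (<[v]> + W)%VS) => le1 le2 le3.
have : W == (<[v]> + W)%VS by rewrite eqEdim addvSr /=; lia.
by move=> /eqP ->; apply: (subvP (addvSl _ _)); apply: memv_line.
Qed.

Lemma artinian_var_squares (n : nat) (K : fieldType) :
  artinian_quotient (ideal_gen (var_squares n K)).
Proof.
move=> J idJ I0J decJ.
(* Each [J i] contains the squares, so membership depends only on squarefree coefficients and [J i]
   amounts to a subspace of a finite-dimensional space. *)
have J_coef i p : J i p <-> J i (sqfree_form (sqfree_coef p)).
  have [_ JD JM] := idJ i; have JK := I0J i _ (sqfree_coefK p).
  split=> Jp; last by rewrite -(subrK (sqfree_form (sqfree_coef p)) p); apply: JD.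
  rewrite -[sqfree_form _](subKr p); apply: JD => //.
  by rewrite -mulN1r; apply: JM.
(* Minimizing the dimension over pairs of an index and its subspace avoids choosing a sequence of
   subspaces. *)
pose Q (x : nat * {vspace {ffun {set 'I_n} -> K^o}}) :=
  forall v, v \in x.2 <-> J x.1 (sqfree_form v).
have exQ i : exists W, Q (i, W).
  apply: (@submod_vspace K _ (fun v => J i (sqfree_form v))) => [|a u v Ju Jv];
    have [J0 JD JM] := idJ i.
    by rewrite linear0.
  by rewrite linearP; apply: JD => //=; rewrite -mul_mpolyC; apply: JM.
have [|[N W] [QN minN]] := @exists_min_measure _ (fun x => \dim x.2) Q.
  by have [W QW] := exQ 0%N; exists (0%N, W).
exists N => i le_Ni; have JiN p : J i p -> J N p.
  rewrite -(subnKC le_Ni); elim: (i - N)%N => [|m IH]; rewrite ?addn0 //.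
  by rewrite addnS => /decJ.
move=> p; split=> [/JiN //|/J_coef JNp]; apply/J_coef.
have [Wi Qi] := exQ i; apply/Qi => /=.
suff /eqP -> : Wi == W by apply/QN.
rewrite eqEdim (minN _ Qi) andbT; apply/subvP=> v /Qi /JiN Jv; exact/QN.
Qed.

End Artinian.

Theorem theorem3p1 (K : fieldType) (charK : [pchar K] =i pred0)
    (n : nat) (hn : (1 <= n)%N) :
  strong_lefschetz (ideal_gen (var_squares n K)) /\
  forall k : nat, (1 <= k)%N -> thin (Ink_gens n K k) (rcons (nseq n 2%N) k).
Proof.
have ell_homog : (\sum_(i < n) 'X_i : {mpoly K[n]}) \is 1.-homog.
  by apply: rpred_sum => i _; rewrite dhomogX; apply/eqP/mdeg1.
split=> [|k k_gt0].
  split; [exact: homogeneous_var_squares | exact: artinian_var_squares |].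
  by exists (\sum_(i < n) 'X_i) => // i k; apply: mul_upn_maximal_rank.
split; last first.
  by exists (corank K 'I_n k) => [|d]; [exact: hilbert_Ink | exact: corank_thin].
(* Only the length of the degree list is rewritten as the size of [enum 'I_n], so induction on that
   list leaves the ring fixed. *)
rewrite /Ink_gens /var_squares -[X in nseq X _]size_enum_ord.
elim: (enum 'I_n) => [|i s IH] /=; rewrite ?IH andbT.
  by have := dhomogMn k ell_homog; rewrite mul1n.
by rewrite (dhomogMn 2 (d := 1)) // dhomogX; apply/eqP/mdeg1.
Qed.
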